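(* Randomization is not helpful for almost-sure winning in one-player and two-player energy, multi energy, energy parity and multi energy parity games: for any such game with objective $\phi$ (where $\phi=\mathsf{PosEnergy}(v_0)$ or $\phi=\mathsf{PosEnergy}(v_0)\cap\mathsf{Parity}$, $v_0\in\mathbb N^k$), if there exists a finite-memory randomized strategy of $\mathcal P_1$ that is almost-surely winning for $\phi$, then there exists a pure strategy of $\mathcal P_1$ that is winning for $\phi$ with the same memory requirements (the same number of memory states).
   Context: A game $G_p=(S_1,S_2,s_{init},E,k,w,p)$ consists of finite disjoint sets $S_1,S_2$ of states of player 1 ($\mathcal P_1$) and player 2 ($\mathcal P_2$), $S=S_1\cup S_2$, $s_{init}\in S$, $E\subseteq S\times S$ such that every state has a successor, $k\in\mathbb N$, $w:E\to\mathbb Z^k$, $p:S\to\mathbb N$. It is one-player if $S_2=\emptyset$. Energy and energy parity games have $k=1$; multi energy (parity) games have arbitrary $k$. A play is an infinite path $\pi=s_0s_1\dots$ with $s_0=s_{init}$. $\mathsf{PosEnergy}(v_0)$ is the set of plays with $v_0+\sum_{i<n}w(s_i,s_{i+1})\in\mathbb N^k$ for all $n\ge0$; $\mathsf{Parity}$ is the set of plays whose least priority visited infinitely often is even. A randomized strategy of $\mathcal P_i$ maps finite prefixes ending in $S_i$ to distributions over successors of the last state; it is pure if these are Dirac. It is finite-memory if encoded by a Moore machine $(M,m_0,\alpha_u,\alpha_n)$ with $M$ finite, deterministic update $\alpha_u:M\times S\to M$ and next-action function $\alpha_n$ from $M\times S_i$ to distributions over $S$ (to $S$ for pure strategies). A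 strategy of $\mathcal P_1$ is almost-surely winning for $\phi$ if against every strategy of $\mathcal P_2$ the play from $s_{init}$ is in $\phi$ with probability $1$; a pure strategy is winning if it is surely winning, i.e. every consistent play is in $\phi$. *)

(* Defs.v *)
From HB Require Import structures.
From mathcomp Require Import all_boot all_order all_algebra.
From mathcomp Require Import all_classical all_reals all_analysis.
From mathcomp Require Import ring lra.

Set Implicit Arguments.
Unset Strict Implicit.
Unset Printing Implicit Defensive.

Import Order.TTheory GRing.Theory Num.Theory.
Import numFieldNormedType.Exports.

Local Open Scope classical_set_scope.
Local Open Scope ring_scope.

(* The states of player 2 are those outside [states1]; the game is one-player
   when [states1] is the full set.  [weight] is only meaningful on edges. *)
Record game (k : nat) := Game {
  state : finType;
  states1 : {set state};
  init : state;
  edge : rel state;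
  edge_total : forall s, exists t, edge s t;
  weight : state -> state -> 'I_k -> int;
  priority : state -> nat }.

Arguments init {k} g.

Definition states2 k (G : game k) : {set state G} := ~: states1 G.

(* All infinite words over the states; the plays are those satisfying
   [is_play]. *)
Definition run k (G : game k) : Type := nat -> state G.

HB.instance Definition _ k (G : game k) :=
  Choice.copy (run G) (nat -> state G).
HB.instance Definition _ k (G : game k) :=
  isPointed.Build (run G) (fun=> init G).

Section Plays.
Context (k : nat) (G : game k).
Implicit Types (pi : run G) (s t : state G).

Definition is_play pi : Prop :=
  pi 0%N = init G /\ forall n, edge (pi n) (pi n.+1).

Definition PosEnergy (v0 : 'I_k -> nat) : set (run G) :=
  [set pi | is_play pi /\ forall (n : nat) (i : 'I_k),
     0 <= (v0 i)%:Z + \sum_(j < n) weight (pi j) (pi j.+1) i].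

Definition infinitely_often pi (q : nat) : Prop :=
  forall n, exists2 m, (n <= m)%N & priority (pi m) = q.

Definition Parity : set (run G) :=
  [set pi | is_play pi /\ exists q,
     [/\ infinitely_often pi q,
         forall q', infinitely_often pi q' -> (q <= q')%N & ~~ odd q]].

Definition cylinder pi (n : nat) : set (run G) :=
  [set pi' | forall i, (i <= n)%N -> pi' i = pi i].

Definition cylinders : set (set (run G)) :=
  [set C | exists pi n, C = cylinder pi n].

Definition run_space := g_sigma_algebraType cylinders.

End Plays.

Arguments Parity {k} G.
Arguments run_space {k} G.

Record fdist (R : realType) (S : finType) := FDist {
  fdist_val :> S -> R;
  fdist_ge0 : forall s, 0 <= fdist_val s;
  fdist_sum1 : \sum_s fdist_val s = 1 }.

(* [sigma rho s] is the move chosen after the prefix [rcons rho s]; only the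
   prefixes whose last state belongs to the player matter.  [A] is
   [fdist R (state G)] for randomized strategies and [state G] for pure ones. *)
Definition strategy k (G : game k) (A : Type) := seq (state G) -> state G -> A.

Section Strategies.
Context (R : realType) (k : nat) (G : game k).
Implicit Types (own : {set state G}) (pi : run G).

(* The player owning [own] only moves along edges, after every finite prefix of
   a play. *)
Definition rand_valid own (sigma : strategy G (fdist R (state G))) : Prop :=
  forall pi, is_play pi -> forall n, pi n \in own ->
  forall t, sigma (mkseq pi n) (pi n) t != 0 -> edge (pi n) t.

Definition pure_valid own (sigma : strategy G (state G)) : Prop :=
  forall pi, is_play pi -> forall n, pi n \in own ->
  edge (pi n) (sigma (mkseq pi n) (pi n)).

Definition joint (sigma tau : strategy G (fdist R (state G))) :
    strategy G (fdist R (state G)) :=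
  fun rho s => if s \in states1 G then sigma rho s else tau rho s.

(* [P] is the law of the run generated from [init G] by the transition
   distributions [kappa]; it exists and is unique, see [outcome_law_exists] and
   [outcome_law_unique]. *)
Definition outcome_law (kappa : strategy G (fdist R (state G)))
    (P : probability (run_space G) R) : Prop :=
  forall pi n, pi 0%N = init G ->
  P (cylinder pi n) =
    (\prod_(i < n) kappa (mkseq pi i) (pi i) (pi i.+1))%:E.

Definition almost_surely_winning (phi : set (run G))
    (sigma : strategy G (fdist R (state G))) : Prop :=
  forall tau, rand_valid (states2 G) tau ->
  forall P : probability (run_space G) R,
    outcome_law (joint sigma tau) P -> P phi = 1%E.

Definition consistent (sigma : strategy G (state G)) pi : Prop :=
  forall n, pi n \in states1 G -> pi n.+1 = sigma (mkseq pi n) (pi n).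

Definition surely_winning (phi : set (run G))
    (sigma : strategy G (state G)) : Prop :=
  forall pi, is_play pi -> consistent sigma pi -> phi pi.

End Strategies.

Record moore k (G : game k) (A : Type) (M : finType) := Moore {
  mem_init : M;
  mem_update : M -> state G -> M;
  next_action : M -> state G -> A }.

(* The memory is updated when a state is left: the action in [s] after [rho] is
   taken with the memory reached by reading [rho] only. *)
Definition moore_strategy k (G : game k) (A : Type) (M : finType)
    (mm : moore G A M) : strategy G A :=
  fun rho s => next_action mm (foldl (mem_update mm) (mem_init mm) rho) s.

(* The sets determined by a prefix of fixed length. *)
Lemma measurable_prefix k (G : game k) (n : nat) (Q : set (run G)) :
  (forall pi pi' : run G, (forall i, (i <= n)%N -> pi' i = pi i) ->
     Q pi -> Q pi') ->
  measurable (Q : set (run_space G)).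
Proof.
move=> Qn.
have -> : Q = \bigcup_(u : seq (state G))
    [set pi : run_space G | Q pi /\ mkseq pi n.+1 = u].
  by apply/seteqP; split=> [pi Qpi|pi [u _ []]//]; exists (mkseq pi n.+1).
apply: countable_bigcupT_measurable => [|u]; first exact: countableP.
have [[pi0 [Qpi0 pi0u]]|no] := pselect (exists pi : run G,
    Q pi /\ mkseq pi n.+1 = u); last first.
  rewrite (_ : [set _ | _] = set0) ?measurable0//.
  by apply/seteqP; split=> // pi Hpi; apply: no; exists pi.
rewrite (_ : [set _ | _] = cylinder pi0 n); last first.
  apply/seteqP; split=> pi /=.
    move=> [Qpi piu] i lein.
    have lti : (i < n.+1)%N by [].
    by rewrite -(nth_mkseq (init G) pi lti) -(nth_mkseq (init G) pi0 lti) piu pi0u.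
  move=> agr; split; first exact: Qn agr Qpi0.
  rewrite -pi0u; apply: (@eq_from_nth _ (init G)); rewrite !size_mkseq// => i lti.
  by rewrite !nth_mkseq// agr.
by apply: sub_sigma_algebra; exists pi0, n.
Qed.

Lemma measurable_plays k (G : game k) :
  measurable ([set pi | is_play pi] : set (run_space G)).
Proof.
rewrite (_ : [set _ | _] = [set pi : run_space G | pi 0%N = init G] `&`
  \bigcap_n [set pi : run_space G | edge (pi n) (pi n.+1)]); last first.
  by apply/seteqP; split=> pi [pi0 H]; split=> // n; [move=> _|]; exact: H.
apply: measurableI.
  by apply: (@measurable_prefix _ _ 0) => pi pi' /= -> //.
apply: bigcapT_measurable => n.
by apply: (@measurable_prefix _ _ n.+1) => pi pi' /= agr; rewrite !agr.
Qed.

Lemma measurable_PosEnergy k (G : game k) (v0 : 'I_k -> nat) :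
  measurable (PosEnergy v0 : set (run_space G)).
Proof.
rewrite (_ : PosEnergy v0 = [set pi | is_play pi] `&`
  \bigcap_n [set pi : run_space G | forall i : 'I_k,
     0 <= (v0 i)%:Z + \sum_(j < n) weight (pi j) (pi j.+1) i]); last first.
  by apply/seteqP; split=> pi [pi0 H]; split=> // n; [move=> _|]; exact: H.
apply: measurableI; first exact: measurable_plays.
apply: bigcapT_measurable => n.
apply: (@measurable_prefix _ _ n) => pi pi' /= agr H i.
rewrite (le_trans (H i))// lerD2l le_eqVlt; apply/orP; left; apply/eqP.
by apply: eq_bigr => j _; rewrite !agr// ltnW.
Qed.

Lemma measurable_Parity k (G : game k) :
  measurable (Parity G : set (run_space G)).
Proof.
have mio q : measurable
    ([set pi | infinitely_often pi q] : set (run_space G)).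
  rewrite (_ : [set _ | _] = \bigcap_n \bigcup_(m in [set m | (n <= m)%N])
    [set pi : run_space G | priority (pi m) = q]); last first.
    apply/seteqP; split=> pi H n; [move=> _|]; have := H n.
      by case=> m; exists m.
    by move=> /(_ Logic.I) [m]; exists m.
  apply: bigcapT_measurable => n; apply: bigcup_measurable => m _.
  by apply: (@measurable_prefix _ _ m) => pi pi' /= ->.
rewrite (_ : Parity G = [set pi | is_play pi] `&`
  \bigcup_(q in [set q | ~~ odd q]) ([set pi : run_space G |
      infinitely_often pi q] `&`
    \bigcap_(q' in [set q' | (q' < q)%N]) ~` [set pi : run_space G |
      infinitely_often pi q'])); last first.
  apply/seteqP; split=> pi [plpi].
    move=> [q [qi qmin eq]]; split=> //; exists q => //; split=> // q' /= ltq iq'.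
    by have := qmin _ iq'; rewrite leqNgt ltq.
  move=> [q eq [qi qmin]]; split=> //; exists q; split=> // q' iq'.
  by rewrite leqNgt; apply/negP => ltq; exact: (qmin q').
apply: measurableI; first exact: measurable_plays.
apply: bigcup_measurable => q _; apply: measurableI => //.
by apply: bigcap_measurableType => q' _; exact: measurableC.
Qed.

Lemma outcome_law_unique (R : realType) k (G : game k)
    (kappa : strategy G (fdist R (state G)))
    (P P' : probability (run_space G) R) :
  outcome_law kappa P -> outcome_law kappa P' ->
  forall A : set (run_space G), measurable A -> P A = P' A.
Proof.
move=> lawP lawP' A mA.
pose H : set (set (run_space G)) := [set C | C = set0 \/ C = setT \/ cylinders C].
have Hm : H `<=` measurable.
  move=> C [->|[->|cC]] //; exact: sub_sigma_algebra.
apply: (@g_sigma_algebra_measure_unique _ _ _ H Hm (fun=> setT)).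
- by move=> _; right; left.
- by rewrite bigcup_const//; exists 0%N.
- have cI (pi pi' : run G) (n n' : nat) : (n <= n')%N ->
      H (cylinder pi n `&` cylinder pi' n').
    move=> lenn'; have [agr|nagr] := pselect (forall i, (i <= n)%N -> pi' i = pi i).
      right; right; exists pi', n'; apply/seteqP; split=> r /=; first by case.
      by move=> rpi'; split=> // i lein; rewrite rpi' ?agr// (leq_trans lein).
    left; apply/seteqP; split=> // r [rpi rpi']; apply: nagr => i lein.
    by rewrite -rpi// rpi'// (leq_trans lein).
  move=> C D [->|[->|[pi [n ->]]]]; rewrite ?set0I ?setTI//; first by left.
  move=> [->|[->|[pi' [n' ->]]]]; rewrite ?setI0 ?setIT; first by left.
    by right; right; exists pi, n.
  have [le|/ltnW le] := leqP n n'; first exact: cI.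
  by rewrite setIC; exact: cI.
- move=> C [->|[->|[pi [n ->]]]]; first by rewrite !measure0.
    by transitivity (1%E : \bar R); [|symmetry]; exact: probability_setT.
  have [pi0|npi0] := eqVneq (pi 0%N) (init G); first by exact: etrans (lawP _ _ pi0) (esym (lawP' _ _ pi0)).
  suff cyl0 (Q : probability (run_space G) R) : outcome_law kappa Q ->
      Q (cylinder pi n) = 0%E.
    exact: etrans (cyl0 _ lawP) (esym (cyl0 _ lawP')).
  move=> lawQ; pose r : run G := fun=> init G.
  have mc (p : run G) m : measurable (cylinder p m : set (run_space G)).
    by apply: sub_sigma_algebra; exists p, m.
  have Qr : Q (cylinder r 0) = 1%E by rewrite lawQ// big_ord0.
  have : (Q (~` (cylinder r 0 : set (run_space G))) = 0)%E.
    by rewrite probability_setC// Qr subee.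
  move=> Qc; apply/eqP; rewrite eq_le measure_ge0 andbT -Qc.
  apply: le_measure; rewrite ?inE//; first exact: measurableC.
  move=> p /= ppi /(_ 0%N (leqnn _)); rewrite ppi// => /eqP.
  by rewrite (negbTE npi0).
- by move=> _; change (P setT < +oo)%E; rewrite probability_setT ltry.
- have sub : cylinders (G := G) `<=` H by move=> C cC; right; right.
  exact: (@sub_sigma_algebra2 _ setT _ _ sub A mA).
Qed.

(* [outcome_law_exists]: a run is sampled from one uniform variable on [0, 1[,
   by successively splitting the interval in proportion to the transition
   probabilities; the cylinder of a word then corresponds to a subinterval whose
   length is the probability of that word. *)
Section Existence.
Context (R : realType) (S : finType).
Implicit Types (d : fdist R S) (x : R) (t u : S).

Definition cumul d (j : nat) : R := \sum_(u | (enum_rank u < j)%N) d u.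

Lemma cumul_rank d t :
  cumul d (enum_rank t).+1 = cumul d (enum_rank t) + d t.
Proof.
rewrite /cumul (bigD1 t)//= addrC; congr (_ + _); apply: eq_bigl => u.
rewrite ltnS leq_eqVlt (inj_eq (@ord_inj _)) (inj_eq enum_rank_inj).
by have [->|ne] := eqVneq u t; rewrite ?ltnn /= ?andbF ?andbT.
Qed.

Lemma cumul0 d : cumul d 0 = 0.
Proof. by rewrite /cumul big_pred0. Qed.

Lemma cumul1 d : cumul d #|S| = 1.
Proof.
by rewrite /cumul -(fdist_sum1 d); apply: eq_bigl => u; rewrite ltn_ord.
Qed.

Lemma cumul_le d i j : (i <= j)%N -> cumul d i <= cumul d j.
Proof.
move=> leij; rewrite /cumul [leRHS](bigID (fun u => (enum_rank u < i)%N))/=.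
rewrite [X in _ <= X + _](_ : _ = \sum_(u | (enum_rank u < i)%N) d u).
  by rewrite lerDl sumr_ge0// => u _; exact: fdist_ge0.
apply: eq_bigl => u; case: (ltnP _ i) => [lt|_]; rewrite ?andbF//.
by rewrite (leq_trans lt).
Qed.

Lemma cumul_ge0 d j : 0 <= cumul d j.
Proof. by rewrite -(cumul0 d) cumul_le. Qed.

Lemma cumul_select d x : exists t, 0 <= x < 1 ->
  cumul d (enum_rank t) <= x < cumul d (enum_rank t) + d t.
Proof.
have t0 : S.
  case: (pickP S) => [//|S0]; exfalso.
  by have := fdist_sum1 d; rewrite big_pred0// => /esym/eqP; rewrite oner_eq0.
have [/andP[x0 x1]|] := boolP (0 <= x < 1); last by exists t0.
have ex : exists j, x < cumul d j by exists #|S|; rewrite cumul1.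
case: (ex_minnP ex) => -[|j]; first by rewrite cumul0 ltNge x0.
move=> xj jmin.
have jS : (j < #|S|)%N by apply: jmin; rewrite cumul1.
exists (enum_val (Ordinal jS)) => _.
rewrite -cumul_rank enum_valK/= xj andbT leNgt; apply/negP => /jmin.
by rewrite ltnn.
Qed.

End Existence.

Section ExistenceRun.
Context (R : realType) (k : nat) (G : game k).
Variable kappa : strategy G (fdist R (state G)).
Implicit Types (pi : run G).

Let pr pi n : R := \prod_(i < n) kappa (mkseq pi i) (pi i) (pi i.+1).
Let lo pi n : R := \sum_(i < n) pr pi i *
  cumul (kappa (mkseq pi i) (pi i)) (enum_rank (pi i.+1)).

Let prS pi n : pr pi n.+1 = pr pi n * kappa (mkseq pi n) (pi n) (pi n.+1).
Proof. by rewrite /pr big_ord_recr. Qed.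

Let loS pi n : lo pi n.+1 = lo pi n + pr pi n *
  cumul (kappa (mkseq pi n) (pi n)) (enum_rank (pi n.+1)).
Proof. by rewrite /lo big_ord_recr. Qed.

Let pr_ge0 pi n : 0 <= pr pi n.
Proof. by apply: prodr_ge0 => i _; exact: fdist_ge0. Qed.

Let eq_mk pi pi' n : (forall i, (i <= n)%N -> pi' i = pi i) ->
  forall i, (i <= n.+1)%N -> mkseq pi' i = mkseq pi i.
Proof.
move=> agr i lein; apply: (@eq_from_nth _ (init G)); rewrite !size_mkseq// => j lt.
by rewrite !nth_mkseq// agr// -ltnS (leq_trans lt).
Qed.

Let eq_pr pi pi' n : (forall i, (i <= n)%N -> pi' i = pi i) ->
  forall m, (m <= n)%N -> pr pi' m = pr pi m.
Proof.
move=> agr m lemn; apply: eq_bigr => i _.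
have lt := leq_trans (ltn_ord i) lemn.
by rewrite (eq_mk agr) ?agr// ltnW// ltnW.
Qed.

Let eq_lo pi pi' n : (forall i, (i <= n)%N -> pi' i = pi i) ->
  lo pi' n = lo pi n.
Proof.
move=> agr; apply: eq_bigr => i _.
have lt := ltn_ord i.
by rewrite (eq_pr agr) ?(eq_mk agr) ?agr// ltnW// ltnW.
Qed.

Let Itv pi n x := lo pi n <= x < lo pi n + pr pi n.

Let ItvS pi n x : Itv pi n.+1 x -> Itv pi n x.
Proof.
rewrite /Itv loS prS.
set L := lo _ _; set p := pr _ _.
set d := kappa _ _; set t := pi n.+1.
have p0 : 0 <= p := pr_ge0 _ _.
have c0 := cumul_ge0 d (enum_rank t).
have c1 : cumul d (enum_rank t) + d t <= 1.
  by rewrite -cumul_rank -(cumul1 d) cumul_le.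
move=> /andP[h1 h2]; apply/andP; split; nra.
Qed.

Let Itv_le pi n m x : (n <= m)%N -> Itv pi m x -> Itv pi n x.
Proof.
elim: m => [|m IH]; first by rewrite leqn0 => /eqP->.
by rewrite leq_eqVlt => /predU1P[->//|/ltnSE le /ItvS]; exact: IH.
Qed.

Let Itv_inj pi pi' n x : pi' 0%N = pi 0%N -> Itv pi n x -> Itv pi' n x ->
  forall i, (i <= n)%N -> pi' i = pi i.
Proof.
move=> e0; elim: n => [_ _ i|n IH Ix Ix' i]; first by rewrite leqn0 => /eqP->.
have agr := IH (ItvS Ix) (ItvS Ix').
rewrite leq_eqVlt => /predU1P[->{i}|]; last by rewrite ltnS; exact: agr.
move: Ix Ix'; rewrite /Itv !loS !prS (eq_lo agr) (eq_pr agr)// (eq_mk agr)// agr//.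
set L := lo _ _; set p := pr _ _; set d := kappa _ _.
have p0 : 0 <= p := pr_ge0 _ _.
suff disj t t' : (enum_rank t < enum_rank t')%N ->
    L + p * cumul d (enum_rank t) <= x <
      L + p * cumul d (enum_rank t) + p * d t ->
    L + p * cumul d (enum_rank t') <= x <
      L + p * cumul d (enum_rank t') + p * d t' -> False.
  move=> h h'; apply/enum_rank_inj/val_inj => /=.
  case: (ltngtP (enum_rank (pi' n.+1)) (enum_rank (pi n.+1))) => // lt.
    by case: (disj _ _ lt h' h).
  by case: (disj _ _ lt h h').
move=> lt /andP[_ h] /andP[h' _].
have := cumul_le d lt; rewrite cumul_rank => hc.
by clear IH agr e0 lt; nra.
Qed.

Let sel (d : fdist R (state G)) (x : R) : state G := projT1 (cid (cumul_select d x)).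
Let selP (d : fdist R (state G)) x : 0 <= x < 1 ->
  cumul d (enum_rank (sel d x)) <= x <
    cumul d (enum_rank (sel d x)) + d (sel d x).
Proof. exact: projT2 (cid (cumul_select d x)). Qed.

Let step (z : seq (state G) * state G * R) :=
  let d := kappa z.1.1 z.1.2 in let t := sel d z.2 in
  (rcons z.1.1 z.1.2, t, (z.2 - cumul d (enum_rank t)) / d t).

Let start x : R := if 0 <= x < 1 then x else 0.
Let st x n := iter n step ([::], init G, start x).
Let sample (x : measurableTypeR R) : run_space G := fun n => (st x n).1.2.

Let start01 x : 0 <= start x < 1.
Proof. by rewrite /start; case: ifP => //; rewrite lexx ltr01. Qed.

Let st_hist x n : (st x n).1.1 = mkseq (sample x) n.
Proof.
elim: n => [//|n IH]; rewrite mkseqS -IH.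
by rewrite /st iterS.
Qed.

Let stP x n : [/\ 0 <= (st x n).2 < 1, 0 < pr (sample x) n &
  start x = lo (sample x) n + pr (sample x) n * (st x n).2].
Proof.
elim: n => [|n [h01 pr0 E]].
  by rewrite start01 /pr /lo !big_ord0 ltr01 add0r mul1r.
have := st_hist x n; rewrite loS prS.
have -> : sample x n.+1 = sel (kappa (st x n).1.1 (st x n).1.2) (st x n).2.
  by rewrite {1}/sample /st iterS.
have -> : (st x n.+1).2 = ((st x n).2 - cumul (kappa (st x n).1.1 (st x n).1.2)
   (enum_rank (sel (kappa (st x n).1.1 (st x n).1.2) (st x n).2))) /
   kappa (st x n).1.1 (st x n).1.2
     (sel (kappa (st x n).1.1 (st x n).1.2) (st x n).2).
  by rewrite /st iterS.
rewrite [sample x n]/sample => <-.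
have := selP (kappa (st x n).1.1 (st x n).1.2) h01.
set d := kappa _ _; set t := sel _ _; set c := cumul _ _; set y := (st x n).2 in h01 E *.
move=> /andP[h1 h2].
have dt : 0 < d t by lra.
split.
- by rewrite divr_ge0 ?subr_ge0 ?(ltW dt)//= ltr_pdivrMr// mul1r; lra.
- by rewrite mulr_gt0.
- by rewrite E; field; rewrite gt_eqF.
Qed.

Let sample_Itv x n : Itv (sample x) n (start x).
Proof.
have [/andP[h0 h1] p0 ->] := stP x n.
by rewrite /Itv; apply/andP; split; nra.
Qed.

Let sampleP pi n x : pi 0%N = init G ->
  cylinder pi n (sample x) <-> Itv pi n (start x).
Proof.
move=> pi0; split=> [c|h].
  have := sample_Itv x n.
  by rewrite /Itv (eq_pr c)// (eq_lo c).
by apply: (Itv_inj _ h (sample_Itv x n)); rewrite pi0.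
Qed.

Let measurable_sample : measurable_fun setT sample.
Proof.
apply: (@measurability _ _ (measurableTypeR R) (run_space G) setT sample (@cylinders _ G)) => //.
move=> _ [_ [pi [n ->]] <-]; rewrite setTI.
have [pi0|npi0] := eqVneq (pi 0%N) (init G); last first.
  rewrite (_ : _ @^-1` _ = set0)//; apply/seteqP; split=> // x /= /(_ 0%N (leq0n _)).
  by rewrite /sample/= => /esym/eqP; rewrite (negbTE npi0).
rewrite (_ : _ @^-1` _ =
  (`[lo pi n, lo pi n + pr pi n[ `&` `[0, 1[) `|`
  (if Itv pi n 0 then ~` `[0, 1[ else set0)).
  apply: measurableU; first exact: measurableI.
  by case: ifP => // _; exact: measurableC.
apply/seteqP; split=> x /=.
  move=> /(sampleP _ _ pi0); rewrite /start.
  case: ifPn => [x01 h|nx01 h]; [left|right]; first by rewrite !in_itv.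
  by rewrite h /= in_itv; exact/negP.
move=> h; apply/(sampleP _ _ pi0); rewrite /start; case: h.
  by rewrite !in_itv/= => -[h ->].
by case: ifPn => // h; rewrite /= in_itv/= => /negP/negbTE ->.
Qed.

Let m01 : measurable (`[0, 1[%classic : set (measurableTypeR R)).
Proof. exact: measurable_itv. Qed.

Let law01 : {measure set (run_space G) -> \bar R} :=
  measure_function_pushforward__canonical__measure_function_Measure
    (mrestr lebesgue_measure m01) measurable_sample.

Lemma outcome_law_exists :
  exists P : probability (run_space G) R, outcome_law kappa P.
Proof.
have law1 : law01 setT = 1%E.
  rewrite /law01/= /pushforward /mrestr preimage_setT setTI lebesgue_measure_itv/=.
  by rewrite lte_fin ltr01 oppr0 adde0.
exists (mnormalize law01 \d_(point : run_space G)) => pi n pi0.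
rewrite /= /mnormalize law1 /= eqe oner_eq0/= invr1 mule1.
rewrite /law01/= /pushforward /mrestr.
rewrite (_ : _ `&` _ = `[lo pi n, lo pi n + pr pi n[%classic).
  rewrite lebesgue_measure_itv/= lte_fin ltrDl.
  case: ifPn => [_|]; first by rewrite -EFinD addrAC subrr add0r.
  rewrite -leNgt => h; congr (_%:E).
  by apply/eqP; rewrite eq_le h pr_ge0.
apply/seteqP; split=> x /=.
  by rewrite !in_itv/= => -[/(sampleP _ _ pi0) + h]; rewrite /start h.
rewrite !in_itv/= => h.
have x01 : 0 <= x < 1.
  have := Itv_le (leq0n n) h.
  by rewrite /Itv /lo /pr !big_ord0 add0r.
by split=> //; apply/(sampleP _ _ pi0); rewrite /start x01.
Qed.

End ExistenceRun.

(* Main.v *)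
(** Let [M] be the memory of the randomized strategy.  Every finite play in its
support has positive probability against the opponent that replays it, so any
pure selection from the support keeps the energy nonnegative surely.  For
parity, move to the product of [M] and the states, where player 1 is restricted
to the support.  This finite parity game is positionally determined.  A
positional winning strategy of player 2 would defeat every run in the support,
hence win almost surely against the randomized strategy; so player 1 has a
positional winning strategy in the product, which is a pure strategy with
memory [M]. *)

Require Import Defs.
From mathcomp Require Import all_boot all_order all_algebra.
From mathcomp Require Import all_classical all_reals all_analysis.

Set Implicit Arguments.
Unset Strict Implicit.
Unset Printing Implicit Defensive.

Import Order.TTheory GRing.Theory Num.Theory.

Local Open Scope classical_set_scope.

(** * The min-parity condition on sequences of priorities *)

Definition recurs (u : nat -> nat) (c : nat) : Prop :=
  forall n, exists2 m, (n <= m)%N & u m = c.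

(** [b] names both a player and the parity this player wants: [true] is the odd player. *)
Definition parity_win (b : bool) (u : nat -> nat) : Prop :=
  exists c, [/\ recurs u c, forall c', recurs u c' -> (c <= c')%N & odd c = b].

Lemma recurs_shift u i c : recurs (fun n => u (i + n)%N) c <-> recurs u c.
Proof.
split=> uc n.
  have [m nm um] := uc n; exists (i + m)%N => //.
  by rewrite (leq_trans nm)// leq_addl.
have [m nm um] := uc (i + n)%N; exists (m - i)%N.
  by rewrite leq_subRL// (leq_trans _ nm)// leq_addr.
by rewrite subnKC// (leq_trans _ nm)// leq_addr.
Qed.

Lemma parity_win_shift b u i :
  parity_win b (fun n => u (i + n)%N) -> parity_win b u.
Proof.
move=> [c [uc cmin cb]]; exists c; split=> //; first exact/(recurs_shift u i).
by move=> c' /(recurs_shift u i); exact: cmin.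
Qed.

Lemma parity_win_inj b b' u : parity_win b u -> parity_win b' u -> b = b'.
Proof.
move=> [c [uc cmin <-]] [c' [uc' cmin' <-]].
by congr odd; apply/eqP; rewrite eqn_leq cmin ?cmin'.
Qed.

(** * Positional determinacy of finite parity games *)

Section ParityGame.
Context (V : finType) (owner : V -> bool) (e : rel V) (p : V -> nat).
Implicit Types (b : bool) (X Y T W : {set V}) (f : V -> V) (q : nat -> V).

(* Inside the arena [X], player [b] following [f] from [W] either stays in [W]
   forever and wins, or leaves [W] through the exit set [T]. *)
Definition wins b X T W f : Prop :=
  [/\ W \subset X :\: T,
      forall x, x \in W -> owner x = b -> e x (f x) && (f x \in T :|: W),
      forall x y, x \in W -> owner x <> b -> y \in X -> e x y ->
        y \in T :|: W
    & forall q, (forall n, q n \in W) -> (forall n, e (q n) (q n.+1)) ->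
        (forall n, owner (q n) = b -> q n.+1 = f (q n)) ->
        parity_win b (p \o q)].

Definition total_in X := forall x, x \in X -> exists2 y, y \in X & e x y.

Lemma wins0 b X T f : wins b X T finset.set0 f.
Proof.
split=> [|x|x y|q qW]; rewrite ?finset.sub0set ?inE//.
by have := qW 0%N; rewrite inE.
Qed.

Lemma wins_path b X W f q : wins b X finset.set0 W f ->
  (forall n, q n \in X) -> q 0%N \in W ->
  (forall n, e (q n) (q n.+1)) ->
  (forall n, q n \in W -> owner (q n) = b -> q n.+1 = f (q n)) ->
  parity_win b (p \o q).
Proof.
move=> [_ own opp win] qX q0 qe qf.
have qW n : q n \in W.
  elim: n => [//|n IH].
  have [bn|/eqP nb] := eqVneq (owner (q n)) b.
    by have /andP[_] := own _ IH bn; rewrite finset.set0U qf.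
  by have := opp _ _ IH nb (qX n.+1) (qe n); rewrite finset.set0U.
by apply: win => // n; exact: qf.
Qed.

(** A run that visits [W] stays there, since it could leave only into [T], which is disjoint from
    both sets; a run that never visits [W] stays in [W']. *)
Lemma winsU b X T W W' f f' : wins b X T W f -> wins b X (T :|: W) W' f' ->
  wins b X T (W :|: W') (fun x => if x \in W then f x else f' x).
Proof.
move=> [sub own opp win] [sub' own' opp' win']; split.
- rewrite finset.subUset sub; apply: fintype.subset_trans sub' _.
  by rewrite finset.setDS// finset.subsetUl.
- move=> x; rewrite inE; case: ifPn => [xW _ /(own _ xW)|_ /= xW' /(own' _ xW')].
    by rewrite !inE orbA => /andP[-> ->].
  by rewrite !inE orbA.
- move=> x y; rewrite inE => /orP[xW|xW'] xb yX xy.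
    by have := opp _ _ xW xb yX xy; rewrite !inE orbA => ->.
  by have := opp' _ _ xW' xb yX xy; rewrite !inE orbA.
- move=> q qW qe qf.
  have [[i qi]|noW] := pselect (exists i, q i \in W); last first.
    have notW n : q n \in W = false.
      by apply/negbTE/negP => qn; apply: noW; exists n.
    apply: win' => // n; first by have := qW n; rewrite inE notW.
    by move=> /qf; rewrite notW.
  have TW n : q n \notin T.
    have := qW n; rewrite inE => /orP[/(fintype.subsetP sub)|/(fintype.subsetP sub')];
    by rewrite !inE ?negb_or => /andP[] // /andP[].
  apply: (@parity_win_shift _ _ i).
  have qiW n : q (i + n)%N \in W.
    elim: n => [|n IH]; first by rewrite addn0.
    have : q (i + n.+1)%N \in T :|: W.
      rewrite addnS; have [bn|/eqP nb] := eqVneq (owner (q (i + n)%N)) b.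
        by rewrite qf// IH; case/andP: (own _ IH bn).
      apply: opp IH nb _ (qe _).
      have := qW (i + n).+1; rewrite inE.
      by move=> /orP[/(fintype.subsetP sub)|/(fintype.subsetP sub')];
        rewrite !inE => /andP[].
    by rewrite inE (negbTE (TW _)).
  apply: (win (fun n => q (i + n)%N)) => // n; first by rewrite addnS.
  by move=> /qf; rewrite addnS qiW.
Qed.

(** One attractor step. The last clause of [wins] is vacuous: the strategy leaves [x] at once. *)
Lemma wins_step b X T x y : x \in X :\: T -> owner x = b -> e x y ->
  y \in T -> wins b X T [set x] (fun=> y).
Proof.
move=> xX xb xy yT; split.
- by rewrite finset.sub1set.
- by move=> z /finset.set1P-> _; rewrite xy inE yT.
- by move=> z z' /finset.set1P->; rewrite xb.
- move=> q qx _ qf; exfalso.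
  have q0 := finset.set1P (qx 0%N); have := qf 0%N; rewrite q0 => /(_ xb) q1.
  have := finset.set1P (qx 1%N); rewrite q1 => yx.
  by move: xX; rewrite inE -yx yT.
Qed.

Lemma wins_forced b X T x : x \in X :\: T -> owner x <> b ->
  (forall y, y \in X -> e x y -> y \in T) -> wins b X T [set x] id.
Proof.
move=> xX xb xT; split.
- by rewrite finset.sub1set.
- by move=> z /finset.set1P->.
- by move=> z y /finset.set1P-> _ yX xy; rewrite inE xT.
- move=> q qx qe _; exfalso; have := qe 0%N.
  move: xX; rewrite (finset.set1P (qx 0%N)) (finset.set1P (qx 1%N)) inE.
  by move=> /andP[/negP xnT xX] /(xT _ xX).
Qed.

(* Edges of [X] leaving [X :\: T] enter [T], where the obligation ends. *)
Lemma wins_enlarge b X T W f :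
  wins b (X :\: T) finset.set0 W f -> wins b X T W f.
Proof.
move=> [sub own opp win]; split=> //.
- by rewrite finset.setD0 in sub.
- move=> x xW /(own _ xW); rewrite !inE => /andP[-> /= ->].
  by rewrite orbT.
- move=> x y xW xb yX xy; rewrite !inE; have [//|yT/=] := boolP (y \in T).
  by have := opp x y xW xb; rewrite !inE yT yX; apply.
Qed.

(** The opponent cannot leave [Y] inside [X], and [f] keeps player [b] in [W], so the larger arena
    offers no new escape. *)
Lemma wins_trap b X Y W f : Y \subset X ->
  (forall x y, x \in Y -> owner x <> b -> y \in X -> e x y -> y \in Y) ->
  wins b Y finset.set0 W f -> wins b X finset.set0 W f.
Proof.
move=> YX trap [sub own opp win]; split=> //.
- by apply: fintype.subset_trans sub _; rewrite !finset.setD0.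
- move=> x y xW xb yX xy; apply: (opp x) => //; apply: trap xb yX xy.
  by move/fintype.subsetP: sub => /(_ _ xW); rewrite finset.setD0.
Qed.

(* [W] cannot be enlarged, even by sets that exit into [W], see [winsU]. *)
Definition maximal b X T W := forall W' f',
  wins b X (T :|: W) W' f' -> W' = finset.set0.

Lemma exists_maximal b X T : exists W f, wins b X T W f /\ maximal b X T W.
Proof.
have [|W /maxsetP[/asboolP[f fW] Wmax] _] :=
  @maxset_exists _ (fun W => `[< exists f, wins b X T W f >]) finset.set0.
  by apply/asboolP; exists id; exact: wins0.
exists W, f; split=> // W' f' fW'.
have /Wmax WW' : `[< exists f, wins b X T (W :|: W') f >].
  by apply/asboolP; eexists; exact: winsU fW fW'.
have [sub _ _ _] := fW'.
apply/finset.setP => x; rewrite inE; apply/negbTE/negP => xW'.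
have : x \in W by rewrite -WW' ?finset.subsetUl// inE xW' orbT.
by move/fintype.subsetP: sub => /(_ _ xW'); rewrite !inE negb_or => /andP[/andP[_ /negP]].
Qed.

(** Otherwise [wins_step] would add [x] to [W]. *)
Lemma maximal_trap b X T W x y : maximal b X T W ->
  x \in X :\: (T :|: W) -> owner x = b -> y \in X -> e x y ->
  y \in X :\: (T :|: W).
Proof.
move=> Wmax xY xb yX xy; rewrite inE yX andbT; apply/negP => yTW.
have /finset.setP/(_ x) := Wmax _ _ (wins_step xY xb xy yTW).
by rewrite !inE eqxx.
Qed.

(** An opponent's vertex with no successor left would be forced into [T :|: W], and [wins_forced]
    would add it. *)
Lemma maximal_total b X T W : maximal b X T W -> total_in X ->
  total_in (X :\: (T :|: W)).
Proof.
move=> Wmax Xtot x xY; have [xb|/eqP xb] := eqVneq (owner x) b.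
  have [|y yX xy] := Xtot x; first by case/finset.setDP: xY.
  by exists y => //; exact: maximal_trap xb yX xy.
apply: contrapT => noy.
suff /Wmax/finset.setP/(_ x) : wins b X (T :|: W) [set x] id.
  by rewrite !inE eqxx.
apply: wins_forced => // y yX xy; apply: contrapT => /negP yTW.
by apply: noy; exists y => //; rewrite inE yTW.
Qed.

(* Zielonka's induction, with maximal winning sets instead of attractors: [B] is
   a maximal set won by the player who dislikes the least priority.  If [B] is
   nonempty, recurse on its complement.  Otherwise the other player can
   everywhere force either a visit to the least priority or a win. *)
Theorem positional_determinacy X x : total_in X -> x \in X ->
  exists b W f, wins b X finset.set0 W f /\ x \in W.
Proof.
have [n] := ubnP #|X|; elim: n => // n IH in X x *; rewrite ltnS => Xn Xtot xX.
(* Outside [T :|: W] lies a smaller arena that [b] cannot leave. A nonempty region won there by [b]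
   would enlarge [W], so induction gives [z] to [~~ b], who then wins it in [X] too. *)
have IHD T W b z : maximal b X T W -> T :|: W != finset.set0 -> T :|: W \subset X ->
    z \in X :\: (T :|: W) ->
    exists W' f', wins (~~ b) X finset.set0 W' f' /\ z \in W'.
  move=> Wmax TW0 TWX zY; set Y := X :\: (T :|: W).
  have [|c [W' [f' [fW' zW']]]] := IH Y z _ (maximal_total Wmax Xtot) zY.
    apply: leq_trans Xn; apply: proper_card; rewrite finset.properEneq.
    rewrite finset.subsetDl andbT; apply/eqP => YX.
    case/finset.set0Pn: TW0 => t tTW; have := fintype.subsetP TWX _ tTW.
    by rewrite -YX inE tTW.
  have [cb|cb] := eqVneq c b.
    have /finset.setP/(_ z) : W' = finset.set0.
      by apply: (Wmax _ f'); apply: wins_enlarge; rewrite -cb.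
    by rewrite inE zW'.
  exists W', f'; split=> //.
  have <- : c = ~~ b by case: (c) (b) cb => [] [].
  apply: wins_trap fW'; first exact: finset.subsetDl.
  move=> u v uY uc vX uv; apply: maximal_trap Wmax uY _ vX uv.
  by case: (owner u) (c) (b) uc cb => [] [] [].
have [x0 x0X x0min] : exists2 x0, x0 \in X & forall y, y \in X -> (p x0 <= p y)%N.
  by case: (arg_minnP p xX) => x0; exists x0.
pose b := odd (p x0).
have [B [g [gB Bmax]]] := exists_maximal (~~ b) X finset.set0.
have BX : B \subset X by case: gB; rewrite finset.setD0.
have [xB|xB] := boolP (x \in B); first by exists (~~ b), B, g.
have [B0|B0] := eqVneq B finset.set0; last first.
  have [|||W' [f' [fW' xW']]] := IHD _ _ _ x Bmax; rewrite ?finset.set0U//.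
    by rewrite inE xB.
  by exists (~~ ~~ b), W', f'.
pose T := [set y in X | p y == p x0].
have [W [f [fW Wmax]]] := exists_maximal b X T.
have TWX : T :|: W \subset X.
  rewrite finset.subUset; apply/andP; split.
    by apply/fintype.subsetP => y; rewrite inE => /andP[].
  by case: fW => sub _ _ _; apply: fintype.subset_trans sub (finset.subsetDl _ _).
(* A vertex outside [T :|: W] would be won by [~~ b] in [X], although the maximal set [B] is
   empty. *)
have TWE y : y \in X -> y \in T :|: W.
  move=> yX; apply: contrapT => /negP yTW.
  have TW0 : T :|: W != finset.set0.
    by apply/finset.set0Pn; exists x0; rewrite !inE x0X eqxx.
  have yY : y \in X :\: (T :|: W) by rewrite inE yTW.
  have [W' [f' [fW' yW']]] := IHD _ _ _ y Wmax TW0 TWX yY.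
  have /finset.setP/(_ y) : W' = finset.set0.
    by apply: (Bmax _ f'); rewrite B0 finset.setU0.
  by rewrite inE yW'.
have [_ own opp win] := fW.
(* Outside [W], that is on [T], any edge inside [X] will do; totality rules out the default [y]. *)
pose h y := if y \in W then f y else odflt y [pick z in X | e y z].
exists b, X, h; split=> //; split.
- by rewrite finset.setD0.
- move=> y yX yb; rewrite finset.set0U /h; case: ifPn => yW.
    by case/andP: (own _ yW yb) => -> /(fintype.subsetP TWX).
  case: pickP => [z /andP[-> ->]//|noz].
  by have [z zX yz] := Xtot y yX; have := noz z; rewrite zX yz.
- by move=> y z _ _ zX _; rewrite finset.set0U.
- move=> q qX qe qh.
  (* Either the least priority recurs, or from some [i] on the run avoids [T], hence stays in [W],
     where [f] wins. *)
  have [rec|] := pselect (recurs (p \o q) (p x0)).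
    exists (p x0); split=> // c' /(_ 0%N) [m _ <-]; exact: x0min.
  move=> /existsNP[i noi]; apply: (@parity_win_shift _ _ i).
  have qW j : q (i + j)%N \in W.
    have := TWE _ (qX (i + j)%N); rewrite !inE => /orP[/andP[_ /eqP pq]|//].
    by exfalso; apply: noi; exists (i + j)%N; rewrite ?leq_addr.
  apply: (win (fun j => q (i + j)%N)) => // j; first by rewrite addnS.
  by move=> /qh; rewrite addnS /h qW.
Qed.

End ParityGame.

Local Open Scope ring_scope.

(** * Runs with only positive moves inside an event of probability one *)

Section Laws.
Context (R : realType) (k : nat) (G : game k).
Variable kappa : strategy G (fdist R (state G)).
Variable P : probability (run_space G) R.
Hypothesis lawP : outcome_law kappa P.
Variable phi : set (run_space G).
Hypotheses (mphi : measurable phi) (P1 : P phi = 1%E).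

Let mcyl (pi : run G) n : measurable (cylinder pi n : set (run_space G)).
Proof. by apply: sub_sigma_algebra; exists pi, n. Qed.

(** The cylinder has positive measure, so it does not fit in the null complement of [phi]. *)
Lemma positive_prefix_meets (pi : run G) n : pi 0%N = init G ->
  (forall i, (i < n)%N -> kappa (mkseq pi i) (pi i) (pi i.+1) != 0) ->
  exists2 pi', phi pi' & cylinder pi n pi'.
Proof.
move=> pi0 pos; apply: contrapT => no.
have Pc : (P (~` phi) = 0)%E.
  rewrite probability_setC//; transitivity (1 - 1 : \bar R)%E; last by rewrite subee.
  by congr (_ - _)%E; exact: P1.
have : (P (cylinder pi n) <= 0)%E.
  rewrite -Pc; apply: le_measure; rewrite ?inE//; first exact: measurableC.
  by move=> pi' pi'c phi'; apply: no; exists pi'.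
rewrite lawP// lee_fin leNgt => /negP; apply; apply: prodr_gt0 => i _.
by rewrite lt_def pos// fdist_ge0.
Qed.

(** The runs from [init G] making some move of probability zero are covered by countably many null
    cylinders, which cannot cover [phi]. *)
Lemma exists_positive_run : (forall pi, phi pi -> pi 0%N = init G) ->
  exists2 pi, phi pi &
    forall n, kappa (mkseq pi n) (pi n) (pi n.+1) != 0.
Proof.
move=> phi0; apply: contrapT => no.
(* Finite words enumerate the cylinders; those of positive measure are replaced by the empty set. *)
pose C (u : seq (state G)) : set (run_space G) :=
  if P (cylinder (nth (init G) u) (size u).-1) == 0%E
  then cylinder (nth (init G) u) (size u).-1 else set0.
pose F i := if unpickle i is Some u then C u else set0.
have mF i : measurable (F i).
  by rewrite /F; case: unpickle => [u|//]; rewrite /C; case: ifP.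
suff negl : P.-negligible phi.
  have /eqP : 1%E = 0%E :> \bar R.
    by apply: etrans (esym P1) _; exact: measure_negligible mphi negl.
  by rewrite eqe oner_eq0.
apply: (@negligibleS _ _ _ P (\bigcup_i F i)); last first.
  apply: negligible_bigcup => i; apply/negligibleP => //.
  rewrite /F; case: unpickle => [u|]; last by rewrite measure0.
  by rewrite /C; case: ifP => [/eqP//|_]; rewrite measure0.
move=> pi phipi.
have [n /eqP k0] : exists n, kappa (mkseq pi n) (pi n) (pi n.+1) == 0.
  apply: contrapT => npos; apply: no; exists pi => // n.
  by apply/negP => ?; apply: npos; exists n.
(* The word must include the target [pi n.+1] of the null move. *)
pose u := mkseq pi n.+2.
have cu : cylinder (nth (init G) u) (size u).-1 = cylinder pi n.+1.
  rewrite size_mkseq /=; apply/seteqP; split=> pi' pi'c i lei.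
    by rewrite pi'c// nth_mkseq.
  by rewrite pi'c// nth_mkseq.
exists (pickle u) => //; rewrite /F pickleK /C cu ifT//.
by rewrite lawP ?phi0// big_ord_recr/= k0 mulr0.
Qed.

End Laws.

(** * Dirac distributions and supports *)

Section PointDist.
Context (R : realType) (S : finType).

Let point_ge0 (t s : S) : 0 <= (s == t)%:R :> R.
Proof. by rewrite ler0n. Qed.

Let point_sum1 (t : S) : \sum_s (s == t)%:R = 1 :> R.
Proof.
rewrite (bigD1 t)//= eqxx big1 ?addr0// => s st.
by rewrite (negbTE st).
Qed.

Definition point_fdist (t : S) : fdist R S :=
  FDist (point_ge0 t) (point_sum1 t).

Lemma point_fdist_neq0 t s : (point_fdist t s != 0) = (s == t).
Proof. by rewrite /= pnatr_eq0 eqb0 negbK. Qed.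

Lemma fdist_support (d : fdist R S) : exists t, d t != 0.
Proof.
apply: contrapT => no; have := fdist_sum1 d; rewrite big1.
  by move=> /esym/eqP; rewrite oner_eq0.
by move=> t _; apply: contrapT => /eqP dt; apply: no; exists t.
Qed.

End PointDist.

(** * From randomized to pure Moore machines *)

Section Purification.
Context (R : realType) (k : nat) (G : game k) (M : finType).
Variable mm : moore G (fdist R (state G)) M.
Hypothesis mm_valid : rand_valid (states1 G) (moore_strategy mm).
Implicit Types (pi : run G) (sel : M -> state G -> state G).

Definition legal (s t : state G) : state G :=
  if edge s t then t else xchoose (edge_total s).

Lemma edge_legal s t : edge s (legal s t).
Proof. by rewrite /legal; case: ifP => // _; exact: xchooseP. Qed.

(* Repairing illegal moves of [next] makes it a valid strategy unconditionally. *)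
Definition point_strategy (next : seq (state G) -> state G -> state G) :
    strategy G (fdist R (state G)) :=
  fun rho s => point_fdist R (legal s (next rho s)).

Lemma point_strategy_valid own next : rand_valid own (point_strategy next).
Proof. by move=> pi _ n _ t; rewrite point_fdist_neq0 => /eqP->; exact: edge_legal. Qed.

Definition memory (rho : seq (state G)) : M :=
  foldl (mem_update mm) (mem_init mm) rho.

Lemma memoryS pi n :
  memory (mkseq pi n.+1) = mem_update mm (memory (mkseq pi n)) (pi n).
Proof. by rewrite /memory mkseqS foldl_rcons. Qed.

Definition purify sel : moore G (state G) M :=
  Moore (mem_init mm) (mem_update mm) sel.

Definition in_support sel :=
  forall m s, s \in states1 G -> next_action mm m s (sel m s) != 0.

Lemma purify_valid sel : in_support sel ->
  pure_valid (states1 G) (moore_strategy (purify sel)).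
Proof. by move=> sup pi plpi n pin; apply: mm_valid => //; exact: sup. Qed.

(** Nonnegativity at time [n] depends only on the prefix up to [n], which a run of [phi] shares. *)
Lemma purify_PosEnergy sel v0 (phi : set (run_space G)) : in_support sel ->
  measurable phi -> phi `<=` PosEnergy v0 ->
  almost_surely_winning phi (moore_strategy mm) ->
  surely_winning (PosEnergy v0) (moore_strategy (purify sel)).
Proof.
move=> sup mphi phiE win pi plpi cpi; split=> // n i.
(* The opponent replays [pi]. As [rho] omits the current state, the next state has index
   [(size rho).+1]. *)
pose tau := point_strategy (fun rho _ => pi (size rho).+1).
have [P lawP] := outcome_law_exists (joint (moore_strategy mm) tau).
have P1 := win tau (@point_strategy_valid _ _) P lawP.
have [||pi' /phiE[_ /(_ n i)] + agr] :=
    @positive_prefix_meets R k G _ P lawP phi mphi P1 pi n.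
- by case: plpi.
- move=> j _; rewrite /joint; case: ifP => jS.
    by rewrite (cpi j jS); exact: sup.
  by rewrite point_fdist_neq0 size_mkseq /legal (plpi.2 j).
- move=> h; apply: (le_trans h); rewrite lerD2l le_eqVlt; apply/orP; left.
  by apply/eqP; apply: eq_bigr => j _; rewrite !agr// ltnW.
Qed.

Definition product_edge (x y : M * state G) : bool :=
  (y.1 == mem_update mm x.1 x.2) &&
  (if x.2 \in states1 G then next_action mm x.1 x.2 y.2 != 0
   else edge x.2 y.2).

(** Hence [true] is player 2, who wants an odd least priority. *)
Definition product_owner (x : M * state G) : bool := x.2 \notin states1 G.

Definition product_run pi n : M * state G := (memory (mkseq pi n), pi n).

Lemma product_total : total_in product_edge [set: M * state G].
Proof.
move=> [m s] _; rewrite /product_edge/=.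
have [t st] : exists t, if s \in states1 G then next_action mm m s t != 0 else edge s t.
  by case: (s \in states1 G); [exact: fdist_support|exact: edge_total].
by exists (mem_update mm m s, t); rewrite ?inE//= eqxx.
Qed.

Lemma purify_Parity (phi : set (run_space G)) :
  measurable phi -> phi `<=` Parity G ->
  almost_surely_winning phi (moore_strategy mm) ->
  exists2 sel, in_support sel &
    surely_winning (Parity G) (moore_strategy (purify sel)).
Proof.
move=> mphi phiP win.
pose prio (x : M * state G) := priority x.2.
have [b [W [f [fW xW]]]] := positional_determinacy product_owner prio
  product_total (finset.in_setT (mem_init mm, init G)).
case: b fW => fW.
(* Player 2 wins the product. Against [f], some run of [phi] makes only positive moves; it is a
   product path following [f] on [W], so its least recurring priority is both even and odd. *)
- pose tau := point_strategy (fun rho s => (f (memory rho, s)).2).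
  have [P lawP] := outcome_law_exists (joint (moore_strategy mm) tau).
  have P1 := win tau (@point_strategy_valid _ _) P lawP.
  have [|pi phipi pos] := @exists_positive_run R k G _ P lawP phi mphi P1.
    by move=> pi /phiP[[]].
  have [[pi0 plpi] [c [cinf cmin ceven]]] := phiP _ phipi.
  have even : parity_win false (prio \o product_run pi).
    by exists c; split=> //; exact/negbTE.
  suff /parity_win_inj/(_ even) : parity_win true (prio \o product_run pi) by [].
  have pe n : product_edge (product_run pi n) (product_run pi n.+1).
    rewrite /product_edge /= memoryS eqxx /=; have := pos n.
    by rewrite /joint; case: ifP.
  apply: (wins_path fW) => //.
    by rewrite /product_run pi0; exact: xW.
  move=> n nW own; have [_ /(_ _ nW own)/andP[/andP[/eqP f1 f2] _] _ _] := fW.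
  have := pos n; rewrite /joint ifN// point_fdist_neq0 => /eqP pinS.
  rewrite [RHS]surjective_pairing f1 /product_run memoryS; congr pair.
  by rewrite pinS /legal; move: f2; rewrite ifN// => ->.
(* [f] is known to stay in the support only on [W]; the fallback secures [in_support] elsewhere. *)
- pose sel m s := let t := (f (m, s)).2 in
    if next_action mm m s t != 0 then t
    else xchoose (fdist_support (next_action mm m s)).
  exists sel => [m s _|pi plpi cpi].
    by rewrite /sel; case: ifP => // _; exact: xchooseP (fdist_support _).
  split=> //.
  suff [c [cinf cmin ceven]] : parity_win false (prio \o product_run pi).
    by exists c; split=> //; rewrite ceven.
  apply: (wins_path fW); first by move=> n; rewrite inE.
  + by case: plpi => pi0 _; rewrite /product_run pi0; exact: xW.
  + move=> n; rewrite /product_edge /= memoryS eqxx /=; case: ifP => nS.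
      rewrite (cpi n nS) /moore_strategy/= /sel; case: ifP => // _.
      exact: xchooseP (fdist_support _).
    exact: plpi.2.
  + move=> n nW own; have [_ /(_ _ nW own)/andP[/andP[/eqP f1 f2] _] _ _] := fW.
    have nS : pi n \in states1 G by move: own => /negbFE.
    rewrite [RHS]surjective_pairing f1 /product_run memoryS; congr pair.
    by move: f2; rewrite (cpi n nS) /= nS /moore_strategy /= /sel => ->.
Qed.

End Purification.

Theorem lemma13 (R : realType) (k : nat) (G : game k) (v0 : 'I_k -> nat)
    (phi : set (run G)) (m : nat) :
  phi = PosEnergy v0 \/ phi = PosEnergy v0 `&` Parity G ->
  (exists (M : finType) (mm : moore G (fdist R (state G)) M),
     [/\ #|M| = m,
         rand_valid (states1 G) (moore_strategy mm) &
         almost_surely_winning phi (moore_strategy mm)]) ->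
  exists (M : finType) (mm : moore G (state G) M),
    [/\ #|M| = m,
        pure_valid (states1 G) (moore_strategy mm) &
        surely_winning phi (moore_strategy mm)].
Proof.
move=> phiE [M [mm [Mm valid win]]]; exists M.
have mE := @measurable_PosEnergy k G v0.
have mP := @measurable_Parity k G.
case: phiE => phiE; rewrite phiE in win *.
(* For energy alone, any selection from the support works. *)
- pose sel m s := xchoose (fdist_support (next_action mm m s)).
  have sup : in_support mm sel by move=> ? ? _; exact: xchooseP (fdist_support _).
  exists (purify mm sel); split=> //; first exact: purify_valid.
  exact: (purify_PosEnergy sup mE _ win).
- have mEP := measurableI _ _ mE mP.
  have [|sel sup winP] := purify_Parity mEP _ win; first exact: subIsetr.
  exists (purify mm sel); split=> //; first exact: purify_valid.
  move=> pi plpi cpi; split; last exact: winP.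
  by apply: (purify_PosEnergy sup mEP _ win) => //; exact: subIsetl.
Qed.
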